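(* Let $f\in L^1(\mathbb{R}^2,\mathbb{H})$ and let $\mathcal{F}_T(u,v)=\int_{\mathbb{R}^2}e^{-\mathbf{i}us}f(s,t)e^{-\mathbf{j}vt}\,ds\,dt$ be its two-sided quaternion Fourier transform. If $\mathcal{F}_T\in L^1(\mathbb{R}^2,\mathbb{H})$, then $$f(s,t)=\frac{1}{4\pi^2}\int_{\mathbb{R}^2}e^{\mathbf{i}su}\mathcal{F}_T(u,v)e^{\mathbf{j}tv}\,du\,dv$$ for almost every $(s,t)\in\mathbb{R}^2$.
   Context: $\mathbb{H}$ is the algebra of quaternions $q=q_0+\mathbf{i}q_1+\mathbf{j}q_2+\mathbf{k}q_3$ ($q_n\in\mathbb{R}$) with the usual Hamilton multiplication ($\mathbf{i}\mathbf{j}=-\mathbf{j}\mathbf{i}=\mathbf{k}$, etc.) and modulus $|q|=(q_0^2+q_1^2+q_2^2+q_3^2)^{1/2}$; $e^{\mathbf{i}\theta}=\cos\theta+\mathbf{i}\sin\theta$ and likewise for $\mathbf{j}$. $L^1(\mathbb{R}^2,\mathbb{H})$ is the space of $f:\mathbb{R}^2\to\mathbb{H}$ with $\int_{\mathbb{R}^2}|f|\,ds\,dt<\infty$; integrals are taken componentwise. *)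

(* Defs.v *)
From HB Require Import structures.
From mathcomp Require Import all_boot all_order all_algebra.
From mathcomp Require Import ring.
From mathcomp Require Import all_classical all_reals all_analysis.

Set Implicit Arguments.
Unset Strict Implicit.
Unset Printing Implicit Defensive.

Import Order.TTheory GRing.Theory Num.Theory.

Local Open Scope ring_scope.

Notation leb2 R := (@lebesgue_measure R \x @lebesgue_measure R)%E.

(* The quaternion q0 + i q1 + j q2 + k q3. *)
Record quat (R : Type) := Quat { q0 : R ; q1 : R ; q2 : R ; q3 : R }.

Section QuatChoice.
Variable R : Type.

Definition tuple_of_quat (q : quat R) := (q0 q, q1 q, q2 q, q3 q).
Definition quat_of_tuple (t : R * R * R * R) :=
  Quat t.1.1.1 t.1.1.2 t.1.2 t.2.

Lemma tuple_of_quatK : cancel tuple_of_quat quat_of_tuple.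
Proof. by case. Qed.

End QuatChoice.

HB.instance Definition _ (R : choiceType) :=
  Choice.copy (quat R) (can_type (@tuple_of_quatK R)).

Section QuatAlgebra.
Variable R : comNzRingType.
Implicit Types p q r : quat R.

Definition quat_zero : quat R := Quat 0 0 0 0.
Definition quat_one : quat R := Quat 1 0 0 0.
Definition quat_opp p : quat R := Quat (- q0 p) (- q1 p) (- q2 p) (- q3 p).
Definition quat_add p q : quat R :=
  Quat (q0 p + q0 q) (q1 p + q1 q) (q2 p + q2 q) (q3 p + q3 q).
Definition quat_scale (a : R) p : quat R :=
  Quat (a * q0 p) (a * q1 p) (a * q2 p) (a * q3 p).
Definition quat_mul p q : quat R :=
  Quat (q0 p * q0 q - q1 p * q1 q - q2 p * q2 q - q3 p * q3 q)
       (q0 p * q1 q + q1 p * q0 q + q2 p * q3 q - q3 p * q2 q)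
       (q0 p * q2 q - q1 p * q3 q + q2 p * q0 q + q3 p * q1 q)
       (q0 p * q3 q + q1 p * q2 q - q2 p * q1 q + q3 p * q0 q).

Local Ltac quat_ring :=
  by repeat case=> ? ? ? ?; congr Quat => /=; ring.

Lemma quat_addA : associative quat_add. Proof. quat_ring. Qed.
Lemma quat_addC : commutative quat_add. Proof. quat_ring. Qed.
Lemma quat_add0 : left_id quat_zero quat_add. Proof. quat_ring. Qed.
Lemma quat_addN : left_inverse quat_zero quat_opp quat_add.
Proof. quat_ring. Qed.

HB.instance Definition _ := GRing.isZmodule.Build (quat R)
  quat_addA quat_addC quat_add0 quat_addN.

Lemma quat_mulA : associative quat_mul. Proof. quat_ring. Qed.
Lemma quat_mul1l : left_id quat_one quat_mul. Proof. quat_ring. Qed.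
Lemma quat_mul1r : right_id quat_one quat_mul. Proof. quat_ring. Qed.
Lemma quat_mulDl : left_distributive quat_mul quat_add.
Proof. quat_ring. Qed.
Lemma quat_mulDr : right_distributive quat_mul quat_add.
Proof. quat_ring. Qed.
Lemma quat_one_neq0 : quat_one != 0 :> quat R.
Proof. by apply/eqP => -[] /eqP; rewrite oner_eq0. Qed.

HB.instance Definition _ := GRing.Zmodule_isNzRing.Build (quat R)
  quat_mulA quat_mul1l quat_mul1r quat_mulDl quat_mulDr quat_one_neq0.

Lemma quat_scaleA a b p :
  quat_scale a (quat_scale b p) = quat_scale (a * b) p.
Proof. by move: p; quat_ring. Qed.
Lemma quat_scale1 : left_id 1 quat_scale. Proof. quat_ring. Qed.
Lemma quat_scaleDr : right_distributive quat_scale +%R.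
Proof. by move=> ?; quat_ring. Qed.
Lemma quat_scaleDl p : {morph quat_scale^~ p : a b / a + b}.
Proof. by move=> a b; move: p; quat_ring. Qed.

HB.instance Definition _ := GRing.Zmodule_isLmodule.Build R (quat R)
  quat_scaleA quat_scale1 quat_scaleDr quat_scaleDl.

Lemma quat_scaleAl (a : R) p q : a *: (p * q) = a *: p * q.
Proof. by move: p q; quat_ring. Qed.
Lemma quat_scaleAr (a : R) p q : a *: (p * q) = p * (a *: q).
Proof. by move: p q; quat_ring. Qed.

HB.instance Definition _ :=
  GRing.Lmodule_isLalgebra.Build R (quat R) quat_scaleAl.
HB.instance Definition _ :=
  GRing.Lalgebra_isAlgebra.Build R (quat R) quat_scaleAr.

Definition quat_i : quat R := Quat 0 1 0 0.
Definition quat_j : quat R := Quat 0 0 1 0.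
Definition quat_k : quat R := Quat 0 0 0 1.

Lemma hamilton : [/\ quat_i * quat_i = -1, quat_j * quat_j = -1,
  quat_k * quat_k = -1, quat_i * quat_j = quat_k & quat_j * quat_i = - quat_k].
Proof. by split; congr Quat => /=; ring. Qed.

Lemma quatE q :
  q = (q0 q)%:A + q1 q *: quat_i + q2 q *: quat_j + q3 q *: quat_k.
Proof. by move: q; quat_ring. Qed.

End QuatAlgebra.

Section QuatFourier.
Variable R : realType.

Definition qabs (q : quat R) : R :=
  Num.sqrt (q0 q ^+ 2 + q1 q ^+ 2 + q2 q ^+ 2 + q3 q ^+ 2).

Definition qexpi (t : R) : quat R := (cos t)%:A + sin t *: quat_i R.
Definition qexpj (t : R) : quat R := (cos t)%:A + sin t *: quat_j R.

Definition qmeasurable (f : R * R -> quat R) : Prop :=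
  [/\ measurable_fun setT (fun x => q0 (f x)),
      measurable_fun setT (fun x => q1 (f x)),
      measurable_fun setT (fun x => q2 (f x)) &
      measurable_fun setT (fun x => q3 (f x))].

(* measurable_fun refers to the Borel sigma-algebra of R * R. A function is
   Lebesgue measurable iff it is almost everywhere equal to a Borel one, and
   its library integral is then that of the Borel function. *)
Definition qL1 (f : R * R -> quat R) : Prop :=
  (exists2 g, qmeasurable g & {ae leb2 R, forall x, f x = g x}) /\
  (\int[leb2 R]_x (qabs (f x))%:E < +oo)%E.

Definition qintegral (f : R * R -> quat R) : quat R :=
  Quat (\int[leb2 R]_x q0 (f x)) (\int[leb2 R]_x q1 (f x))
       (\int[leb2 R]_x q2 (f x)) (\int[leb2 R]_x q3 (f x)).

Definition qFourier (f : R * R -> quat R) (w : R * R) : quat R :=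
  qintegral (fun x => qexpi (- (w.1 * x.1)) * f x * qexpj (- (w.2 * x.2))).

End QuatFourier.

(* Main.v *)
From HB Require Import structures.
Require Import Defs.
From mathcomp Require Import all_boot all_order all_algebra.
From mathcomp Require Import ring lra.
From mathcomp Require Import all_classical all_reals all_analysis.
From mathcomp Require Import measurable_realfun simple_functions.

Set Implicit Arguments.
Unset Strict Implicit.
Unset Printing Implicit Defensive.

Import Order.TTheory GRing.Theory Num.Theory.
Import numFieldNormedType.Exports.
Import HBNNSimple.
Local Open Scope classical_set_scope.
Local Open Scope ring_scope.

(** Write e_i and e_j for the exponentials in the quaternions [i] and [j], F
    for the transform of f, and g (s, t) for the integral of
    e_i (s u) F (u, v) e_j (t v) over the plane of all (u, v). Putting the
    definition of F inside g and exchanging the integrals is not legitimate,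
    because e_i (u (s - s')) f (s', t') e_j (v (t - t')) is not integrable in
    (u, v). So the frequency integral is damped by exp (- e (|u| + |v|)) with
    e > 0, which makes everything absolutely convergent. A real factor
    commutes with quaternions, so the frequency integral can be evaluated
    around a fixed value of f: sines cancel by parity, cosines give the Poisson
    kernel, normalised as 2 e / (e ^ 2 + x ^ 2), in each variable
    ([qintegral_damping_kernel]), and the damped g is f smoothed by a product of
    two Poisson kernels ([qFourier_damped]).

    Rather than proving that this smoothing converges to f at almost every
    point, both sides are integrated over a box of the (s, t) plane. The Poisson
    kernel integrates to a difference of arctangents, so the smoothed side
    becomes an integral of f against an explicit bounded weight
    ([qintegral_box_poisson]); as e tends to 0 this weight tends to
    4 pi ^ 2 times the indicator of the box, except on the four lines that bound
    it. On the other side F is integrable, so dominated convergence removes the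
    damping. Hence g and 4 pi ^ 2 f have the same integral over every box
    ([qintegral_box_inversion]). Boxes form a pi-system generating the Borel
    sets of the plane, so g = 4 pi ^ 2 f almost everywhere
    ([ae_eq0_boxes]).

    Quaternion-valued integrals are handled through their four real coordinates
    [qcoord k]; multiplication by a unit exponential preserves [qabs], which
    supplies all the dominating functions. *)

(** * Real integrals: null sets, iterated integrals, dominated convergence *)

Section AeIntegral.
Local Open Scope ereal_scope.
Context d (T : measurableType d) (R : realType).
Variable mu : {measure set T -> \bar R}.

(** The integral of a nonnegative function, measurable or not, is a supremum over
    the simple functions below it. Multiplying such a simple function by the
    indicator of the complement of a null set does not change its integral, and
    makes it a competitor for any function that agrees off the null set. *)
Lemma nonmeasurable_ge0_le_integral (N : set T) (f g : T -> \bar R) :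
  measurable N -> mu N = 0 ->
  (forall x, 0 <= f x) -> (forall x, 0 <= g x) ->
  (forall x, ~ N x -> f x = g x) -> \int[mu]_x f x <= \int[mu]_x g x.
Proof.
move=> mN N0 f0 g0 fg; rewrite !ge0_integralTE//.
apply: ge_ereal_sup => _ [h hf <-].
have mC : measurable (~` N) by exact: measurableC.
pose h' := mul_nnsfun h (indic_nnsfun R mC).
have -> : sintegral mu h = sintegral mu h'.
  rewrite -!integralT_nnsfun; apply: ae_eq_integral => //.
  - exact/measurable_EFinP.
  - exact/measurable_EFinP.
  - exists N; split => // x /=; apply: contra_notP => Nx _.
    by rewrite /h' /= /mindic indicE mem_set// mulr1.
apply: ereal_sup_ubound => /=; exists h' => // x; rewrite /h' /= /mindic indicE.
have [xN|xN] := boolP (x \in ~` N).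
  by rewrite mulr1 -fg//; exact/set_mem.
by rewrite mulr0.
Qed.

Lemma nonmeasurable_ae_eq_integral (f g : T -> \bar R) :
  {ae mu, forall x, f x = g x} -> \int[mu]_x f x = \int[mu]_x g x.
Proof.
move=> [N [mN N0 fgN]].
have fg x : ~ N x -> f x = g x by move=> nNx; apply: contrapT => /fgN.
rewrite integralE [RHS]integralE; congr (_ - _).
  by apply/eqP; rewrite eq_le; apply/andP; split;
    apply: (nonmeasurable_ge0_le_integral mN N0) => // x /fg;
    rewrite !funeposE => ->.
by apply/eqP; rewrite eq_le; apply/andP; split;
  apply: (nonmeasurable_ge0_le_integral mN N0) => // x /fg;
  rewrite !funenegE => ->.
Qed.

End AeIntegral.

Section RealIntegral.
Context d1 d2 (T1 : measurableType d1) (T2 : measurableType d2) (R : realType).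
Variable m1 : {sigma_finite_measure set T1 -> \bar R}.
Variable m2 : {sigma_finite_measure set T2 -> \bar R}.

Lemma measurable_Rintegral_param (h : T1 * T2 -> R) :
  measurable_fun setT h -> measurable_fun setT (fun x => \int[m2]_y h (x, y)).
Proof.
move=> mh; apply: (measurableT_comp (fine_measurable measurableT)).
have mE : measurable_fun setT (EFin \o h) by exact/measurable_EFinP.
apply: (eq_measurable_fun (fun x => (\int[m2]_y (EFin \o h)^\+ (x, y) -
   \int[m2]_y (EFin \o h)^\- (x, y))%E)) => [x _|].
  rewrite [RHS]integralE; congr (_ - _)%E; apply: eq_integral => y _;
  by rewrite ?funeposE ?funenegE.
apply: emeasurable_funB; apply: measurable_fun_fubini_tonelli_F => //.
  exact: measurable_funepos.
exact: measurable_funeneg.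
Qed.

Lemma integrable_dominated d (T : measurableType d)
    (mu : {measure set T -> \bar R}) (f g : T -> R) :
  measurable_fun setT f -> mu.-integrable setT (EFin \o g) ->
  (forall x, `|f x| <= g x) -> mu.-integrable setT (EFin \o f).
Proof.
move=> mf ig fg; apply: (le_integrable measurableT _ _ ig).
  exact/measurable_EFinP.
by move=> x _; rewrite /= lee_fin (le_trans (fg x))// ler_norm.
Qed.

Lemma integrable_scale d (T : measurableType d)
    (mu : {measure set T -> \bar R}) (k : R) (f : T -> R) :
  mu.-integrable setT (EFin \o f) ->
  mu.-integrable setT (EFin \o (fun x => k * f x)).
Proof. by move=> fi; apply: (integrableZl measurableT k) fi. Qed.

(** Integrands are dominated below by products of a function of each variable:
    for these, integrability on the product space is a consequence of
    integrability of the factors. *)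
Lemma integrable_tensor (f : T1 -> R) (g : T2 -> R) :
  m1.-integrable setT (EFin \o f) -> m2.-integrable setT (EFin \o g) ->
  (m1 \x m2)%E.-integrable setT (EFin \o (fun z => f z.1 * g z.2)).
Proof.
move=> fi gi.
have mf : measurable_fun setT f by apply/measurable_EFinP; exact: measurable_int fi.
have mg : measurable_fun setT g by apply/measurable_EFinP; exact: measurable_int gi.
apply/integrable12ltyP.
  by apply/measurable_EFinP/measurable_funM; exact: measurableT_comp.
under eq_integral => x _.
  under eq_integral => y _ do rewrite /= normrM EFinM.
  rewrite ge0_integralZl//=; last by apply/measurable_EFinP/measurableT_comp.
  over.
have [_ fy] := integrableP _ _ _ fi; have [_ gy] := integrableP _ _ _ gi.
rewrite ge0_integralZr//=; last 2 first.
  - by apply/measurable_EFinP/measurableT_comp.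
  - by apply: integral_ge0 => *; rewrite lee_fin.
by apply: lte_mul_pinfty => //;
  rewrite ?integral_ge0// ge0_fin_numE// integral_ge0.
Qed.

(** Domination by a tensor product makes every section integrable, not just
    almost every one; this is what allows to pass between extended-valued
    and real-valued inner integrals. *)
Lemma Fubini_dominated (h : T1 * T2 -> R) (f : T1 -> R) (g : T2 -> R) :
  measurable_fun setT h ->
  m1.-integrable setT (EFin \o f) -> m2.-integrable setT (EFin \o g) ->
  (forall x y, `|h (x, y)| <= f x * g y) ->
  \int[m1]_x \int[m2]_y h (x, y) = \int[m2]_y \int[m1]_x h (x, y).
Proof.
move=> mh fi gi hfg.
have hi : (m1 \x m2)%E.-integrable setT (EFin \o h).
  apply: integrable_dominated (integrable_tensor fi gi) _ => //.
  by move=> -[x y]; exact: hfg.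
have h1 x : m2.-integrable setT (fun y => (h (x, y))%:E).
  apply: (@integrable_dominated _ _ _ _ (fun y => f x * g y)) => //.
    exact: measurableT_comp.
  exact: integrable_scale gi.
have h2 y : m1.-integrable setT (fun x => (h (x, y))%:E).
  apply: (@integrable_dominated _ _ _ _ (fun x => g y * f x)).
  - exact: measurableT_comp.
  - exact: integrable_scale fi.
  - by move=> x; rewrite mulrC.
have /(congr1 fine) := Fubini hi; rewrite /Rintegral => E.
transitivity (fine (\int[m1]_x \int[m2]_y (h (x, y))%:E)%E).
  by congr fine; apply: eq_integral => x _; rewrite fineK// integrable_fin_num.
rewrite [LHS]E.
by congr fine; apply: eq_integral => x _; rewrite fineK// integrable_fin_num.
Qed.

Lemma Rintegral_tensor (f : T1 -> R) (g : T2 -> R) :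
  m1.-integrable setT (EFin \o f) -> m2.-integrable setT (EFin \o g) ->
  \int[(m1 \x m2)%E]_z (f z.1 * g z.2) = (\int[m1]_x f x) * (\int[m2]_y g y).
Proof.
move=> fi gi; rewrite /Rintegral -integral12_prod_meas1//=; last first.
  exact: integrable_tensor.
rewrite -/(Rintegral _ _ _) -RintegralZr// /Rintegral.
congr fine; apply: eq_integral => x _.
rewrite /fubini_F /=; under eq_integral do rewrite EFinM.
by rewrite integralZl//= EFinM fineK// integrable_fin_num.
Qed.

End RealIntegral.

Lemma Rdominated_convergence d (T : measurableType d) (R : realType)
    (mu : {measure set T -> \bar R}) (f_ : (T -> R)^nat) (f g : T -> R) :
  (forall n, measurable_fun setT (f_ n)) -> measurable_fun setT f ->
  {ae mu, forall x, f_ ^~ x @ \oo --> f x} ->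
  mu.-integrable setT (EFin \o g) ->
  (forall n x, `|f_ n x| <= g x) ->
  \int[mu]_x f_ n x @[n --> \oo] --> \int[mu]_x f x.
Proof.
move=> mf_ mf f_f ig fg.
have [fi _ cv] : [/\ mu.-integrable setT (EFin \o f),
  [sequence (\int[mu]_x (`|(f_ n x)%:E - (f x)%:E|))%E]_n @ \oo --> 0%E &
  [sequence (\int[mu]_x (f_ n x)%:E)%E]_n @ \oo --> (\int[mu]_x (f x)%:E)%E].
  apply: (@dominated_convergence _ _ _ _ _ _ (fun n => EFin \o f_ n) _
    (EFin \o g)) => //.
  - by move=> n; exact/measurable_EFinP.
  - exact/measurable_EFinP.
  - by apply: filterS f_f => x cx _; apply: cvg_EFin => //; exact: nearW.
  - by apply: aeW => x n _ /=; rewrite lee_fin.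
apply: fine_cvg; rewrite fineK//; last exact: integrable_fin_num.
Qed.

Section ProductSigmaFinite.
Local Open Scope ereal_scope.
Context d1 d2 (T1 : measurableType d1) (T2 : measurableType d2) (R : realType).
Variables (m1 : {sigma_finite_measure set T1 -> \bar R})
  (m2 : {sigma_finite_measure set T2 -> \bar R}).

Lemma sigma_finite_product : sigma_finite setT (m1 \x m2).
Proof.
have /sigma_finiteP[F [TF ndF Foo]] := sigma_finiteT m1.
have /sigma_finiteP[G [TG ndG Goo]] := sigma_finiteT m2.
exists (fun n => F n `*` G n).
  rewrite -setXTT TF TG predeqE => -[x y]; split.
    move=> [/= [n _ Fnx] [k _ Gky]]; exists (maxn n k) => //; split.
    - by move: x Fnx; exact/subsetPset/ndF/leq_maxl.
    - by move: y Gky; exact/subsetPset/ndG/leq_maxr.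
  by move=> [n _ []/= ? ?]; split; exists n.
move=> k; have [? ?] := Foo k; have [? ?] := Goo k.
split; first exact: measurableX.
by rewrite product_measure1E// lte_mul_pinfty// ge0_fin_numE.
Qed.

End ProductSigmaFinite.

(** The Lebesgue measure of the plane, under a name that carries the
    sigma-finite structure used by the theorems on iterated integrals. *)
Definition plane_measure (R : realType) :
  set (measurableTypeR R * measurableTypeR R) -> \bar R := leb2 R.

HB.instance Definition _ (R : realType) :=
  Measure.copy (@plane_measure R) (leb2 R).
HB.instance Definition _ (R : realType) :=
  Measure_isSigmaFinite.Build _ _ _ (@plane_measure R)
    (sigma_finite_product (@lebesgue_measure R) (@lebesgue_measure R)).

(** * Coordinates and modulus of quaternions *)

Section QuatCoord.
Variable R : realType.
Implicit Types p q r : quat R.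

(** The coordinates as one family indexed by [nat], so that statements about all
    four of them are a single quantification. *)
Definition qcoord (k : nat) (q : quat R) : R :=
  match k with 0 => q0 q | 1 => q1 q | 2 => q2 q | _ => q3 q end.

Lemma qcoordP p q : (forall k, qcoord k p = qcoord k q) -> p = q.
Proof.
by move=> e; move: (e 0%N) (e 1%N) (e 2%N) (e 3%N); case: p {e} => a b c d;
  case: q => a' b' c' d' /= -> -> -> ->.
Qed.

Lemma qcoordD k p q : qcoord k (p + q) = qcoord k p + qcoord k q.
Proof. by case: k => [|[|[|k]]]. Qed.

Lemma qcoordZ k (a : R) q : qcoord k (a *: q) = a * qcoord k q.
Proof. by case: k => [|[|[|k]]]. Qed.

Lemma qcoordB k p q : qcoord k (p - q) = qcoord k p - qcoord k q.
Proof. by case: k => [|[|[|k]]]. Qed.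

Lemma qabs_ge0 q : 0 <= qabs q.
Proof. exact: sqrtr_ge0. Qed.

Lemma qcoord_le_qabs k q : `|qcoord k q| <= qabs q.
Proof.
rewrite -sqrtr_sqr ler_sqrt; last by rewrite !addr_ge0// sqr_ge0.
have h (a : R) : 0 <= a ^+ 2 by exact: sqr_ge0.
have := h (q0 q); have := h (q1 q); have := h (q2 q); have := h (q3 q).
by case: k => [|[|[|k]]] /=; lra.
Qed.

Lemma qabs_le_sum q :
  qabs q <= `|q0 q| + `|q1 q| + `|q2 q| + `|q3 q|.
Proof.
rewrite -[leRHS]ger0_norm; last by rewrite !addr_ge0.
rewrite -sqrtr_sqr ler_sqrt; last exact: sqr_ge0.
rewrite -(real_normK (num_real (q0 q))) -(real_normK (num_real (q1 q))).
rewrite -(real_normK (num_real (q2 q))) -(real_normK (num_real (q3 q))).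
have := normr_ge0 (q0 q); have := normr_ge0 (q1 q).
have := normr_ge0 (q2 q); have := normr_ge0 (q3 q).
move: `|q0 q| `|q1 q| `|q2 q| `|q3 q| => a b c d d0 c0 b0 a0.
have := mulr_ge0 a0 b0; have := mulr_ge0 a0 c0; have := mulr_ge0 a0 d0.
have := mulr_ge0 b0 c0; have := mulr_ge0 b0 d0; have := mulr_ge0 c0 d0.
nra.
Qed.

(** Euler's four-square identity. *)
Lemma qabsM p q : qabs (p * q) = qabs p * qabs q.
Proof.
rewrite /qabs -sqrtrM; last by rewrite !addr_ge0// sqr_ge0.
by congr Num.sqrt; case: p q => [a b c d] [a' b' c' d'] /=; ring.
Qed.

Lemma qabsZ (a : R) q : qabs (a *: q) = `|a| * qabs q.
Proof.
rewrite /qabs -sqrtr_sqr -sqrtrM; last exact: sqr_ge0.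
by congr Num.sqrt; case: q => [b c d e] /=; ring.
Qed.

Lemma qabs_expi t : qabs (@qexpi R t) = 1.
Proof.
rewrite -[RHS]sqrtr1 -(cos2Dsin2 t); congr Num.sqrt.
by rewrite /qexpi /=; ring.
Qed.

Lemma qabs_expj t : qabs (@qexpj R t) = 1.
Proof.
rewrite -[RHS]sqrtr1 -(cos2Dsin2 t); congr Num.sqrt.
by rewrite /qexpj /=; ring.
Qed.

Lemma qabs_sandwich s t q : qabs (qexpi s * q * qexpj t) = qabs q.
Proof. by rewrite !qabsM qabs_expi qabs_expj mul1r mulr1. Qed.

Lemma qexpiD s t : @qexpi R (s + t) = qexpi s * qexpi t.
Proof.
by rewrite /qexpi cosD sinD; congr Quat => /=; ring.
Qed.

Lemma qexpjD s t : @qexpj R (s + t) = qexpj s * qexpj t.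
Proof.
by rewrite /qexpj cosD sinD; congr Quat => /=; ring.
Qed.

(** In coordinates the two-sided exponential kernel is a combination of four
    quaternions free of [s] and [t], with products of one-variable real functions
    as coefficients: integrals against it factor into one-variable integrals. *)
Lemma sandwichE s t q : qexpi s * q * qexpj t =
  (cos s * cos t) *: q + (cos s * sin t) *: (q * quat_j R) +
  (sin s * cos t) *: (quat_i R * q) +
  (sin s * sin t) *: (quat_i R * q * quat_j R).
Proof. by case: q => a b c d; congr Quat => /=; ring. Qed.

End QuatCoord.

(** * Measurability and integration of quaternion-valued functions *)

Section QuatMeasurable.
Variable R : realType.

Definition qmeas d (T : measurableType d) (f : T -> quat R) :=
  forall k, measurable_fun setT (fun x => qcoord k (f x)).

Lemma qmeasP (f : R * R -> quat R) : qmeasurable f <-> qmeas f.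
Proof.
split; first by case=> *; case=> [|[|[|k]]].
by move=> mf; split; [exact: (mf 0%N)|exact: (mf 1%N)|exact: (mf 2%N)
  |exact: (mf 3%N)].
Qed.

Context d (T : measurableType d).
Implicit Types f g : T -> quat R.

Lemma qmeas_cst q : qmeas (fun _ : T => q).
Proof. by move=> k; exact: measurable_cst. Qed.

Lemma qmeasD f g : qmeas f -> qmeas g -> qmeas (fun x => f x + g x).
Proof.
move=> mf mg k; under eq_fun do rewrite qcoordD.
exact: measurable_funD.
Qed.

Lemma qmeasZ (a : T -> R) f : measurable_fun setT a -> qmeas f ->
  qmeas (fun x => a x *: f x).
Proof.
move=> ma mf k; under eq_fun do rewrite qcoordZ.
exact: measurable_funM.
Qed.

Lemma qmeasM f g : qmeas f -> qmeas g -> qmeas (fun x => f x * g x).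
Proof.
move=> mf mg.
have mfg i j : measurable_fun setT (fun x => qcoord i (f x) * qcoord j (g x)).
  exact: measurable_funM.
case=> [|[|[|k]]] /=.
- apply: measurable_funB (mfg 3%N 3%N); apply: measurable_funB (mfg 2%N 2%N).
  exact: measurable_funB (mfg 0%N 0%N) (mfg 1%N 1%N).
- apply: measurable_funB (mfg 3%N 2%N); apply: measurable_funD (mfg 2%N 3%N).
  exact: measurable_funD (mfg 0%N 1%N) (mfg 1%N 0%N).
- apply: measurable_funD (mfg 3%N 1%N); apply: measurable_funD (mfg 2%N 0%N).
  exact: measurable_funB (mfg 0%N 2%N) (mfg 1%N 3%N).
- apply: measurable_funD (mfg 3%N 0%N); apply: measurable_funB (mfg 2%N 1%N).
  exact: measurable_funD (mfg 0%N 3%N) (mfg 1%N 2%N).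
Qed.

Lemma qmeas_expi (a : T -> R) : measurable_fun setT a ->
  qmeas (fun x => qexpi (a x)).
Proof.
move=> ma; apply: qmeasD; apply: qmeasZ; try exact: qmeas_cst.
  by apply: measurableT_comp ma; apply: continuous_measurable_fun => ?;
    exact: continuous_cos.
by apply: measurableT_comp ma; apply: continuous_measurable_fun => ?;
    exact: continuous_sin.
Qed.

Lemma qmeas_expj (a : T -> R) : measurable_fun setT a ->
  qmeas (fun x => qexpj (a x)).
Proof.
move=> ma; apply: qmeasD; apply: qmeasZ; try exact: qmeas_cst.
  by apply: measurableT_comp ma; apply: continuous_measurable_fun => ?;
    exact: continuous_cos.
by apply: measurableT_comp ma; apply: continuous_measurable_fun => ?;
    exact: continuous_sin.
Qed.

Lemma qmeas_sandwich (a b : T -> R) f :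
  measurable_fun setT a -> measurable_fun setT b -> qmeas f ->
  qmeas (fun x => qexpi (a x) * f x * qexpj (b x)).
Proof.
move=> ma mb mf; apply: qmeasM (qmeas_expj mb); apply: qmeasM mf.
exact: qmeas_expi.
Qed.

Lemma measurable_qabs f : qmeas f -> measurable_fun setT (fun x => qabs (f x)).
Proof.
move=> mf; rewrite /qabs.
apply: (measurableT_comp (continuous_measurable_fun (@sqrt_continuous R))).
have m2 k : measurable_fun setT (fun x => qcoord k (f x) ^+ 2).
  exact: measurable_funX.
by apply: measurable_funD (m2 3%N); apply: measurable_funD (m2 2%N);
  exact: measurable_funD (m2 0%N) (m2 1%N).
Qed.

End QuatMeasurable.

Lemma qmeas_comp d d' (T : measurableType d) (T' : measurableType d')
    (R : realType) (f : T -> quat R) (a : T' -> T) :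
  qmeas f -> measurable_fun setT a -> qmeas (fun x => f (a x)).
Proof. by move=> mf ma k; exact: measurableT_comp (mf k) ma. Qed.

Section QuatIntegral.
Variable R : realType.
Implicit Types f g : R * R -> quat R.

Lemma ae_leb2S (P Q : R * R -> Prop) : (forall x, P x -> Q x) ->
  {ae leb2 R, forall x, P x} -> {ae leb2 R, forall x, Q x}.
Proof.
by move=> PQ [N [mN N0 PN]]; exists N; split=> // x nQ; apply: PN => /PQ.
Qed.

Lemma ae_leb2I (P Q : R * R -> Prop) : {ae leb2 R, forall x, P x} ->
  {ae leb2 R, forall x, Q x} -> {ae leb2 R, forall x, P x /\ Q x}.
Proof.
move=> [N [mN N0 PN]] [M [mM M0 QM]]; exists (N `|` M); split.
- exact: measurableU.
- exact: null_set_setU.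
- move=> x /= nPQ; have [Px|nPx] := pselect (P x); last by left; exact: PN.
  by right; apply: QM => Qx; apply: nPQ.
Qed.

Definition qintegrable f :=
  forall k, (leb2 R).-integrable setT (EFin \o (fun x => qcoord k (f x))).

Lemma qcoord_integral k f : qcoord k (qintegral f) =
  \int[leb2 R]_x qcoord k (f x).
Proof. by case: k => [|[|[|k]]]. Qed.

Lemma eq_qintegral f g : f =1 g -> qintegral f = qintegral g.
Proof. by move=> /funext ->. Qed.

Lemma qintegrable_meas f : qintegrable f -> qmeas f.
Proof.
by move=> fi k; apply/measurable_EFinP; exact: (measurable_int _ (fi k)).
Qed.

Lemma qintegrable_dominated f (F : R * R -> R) : qmeas f ->
  (leb2 R).-integrable setT (EFin \o F) ->
  (forall x, qabs (f x) <= F x) -> qintegrable f.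
Proof.
move=> mf Fi fF k; apply: integrable_dominated Fi _; first exact: mf.
by move=> x; exact: le_trans (qcoord_le_qabs _ _) (fF x).
Qed.

Lemma integrable_qabs f : qintegrable f ->
  (leb2 R).-integrable setT (EFin \o (fun x => qabs (f x))).
Proof.
move=> fi; have a k : (leb2 R).-integrable setT
    (EFin \o (fun x => `|qcoord k (f x)|)).
  exact: (integrable_abse (fi k)).
apply: (@integrable_dominated _ _ _ (leb2 R) _
  (fun x => `|q0 (f x)| + `|q1 (f x)| + `|q2 (f x)| + `|q3 (f x)|)).
- by apply: measurable_qabs; exact: qintegrable_meas.
- have D (u v : R * R -> R) : (leb2 R).-integrable setT (EFin \o u) ->
     (leb2 R).-integrable setT (EFin \o v) ->
     (leb2 R).-integrable setT (EFin \o (fun x => u x + v x)).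
    exact: integrableD.
  exact: (D _ _ (D _ _ (D _ _ (a 0%N) (a 1%N)) (a 2%N)) (a 3%N)).
- by move=> x; rewrite ger0_norm ?qabs_ge0//; exact: qabs_le_sum.
Qed.

Lemma qintegral_ae_eq f g : {ae leb2 R, forall x, f x = g x} ->
  qintegral f = qintegral g.
Proof.
move=> fg; apply: qcoordP => k; rewrite !qcoord_integral; congr fine.
have fgk : {ae leb2 R, forall x, (qcoord k (f x))%:E = (qcoord k (g x))%:E}.
  by apply: (ae_leb2S _ fg) => x ->.
exact: nonmeasurable_ae_eq_integral fgk.
Qed.

Lemma qintegralD f g : qintegrable f -> qintegrable g ->
  qintegral (fun x => f x + g x) = qintegral f + qintegral g.
Proof.
move=> fi gi; apply: qcoordP => k; rewrite qcoordD !qcoord_integral.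
by under eq_Rintegral do rewrite qcoordD; rewrite RintegralD.
Qed.

Lemma qintegrableD f g : qintegrable f -> qintegrable g ->
  qintegrable (fun x => f x + g x).
Proof.
move=> fi gi k; rewrite (_ : EFin \o _ = fun x =>
  ((qcoord k (f x))%:E + (qcoord k (g x))%:E)%E).
  by apply: (integrableD measurableT (fi k) (gi k)).
by apply/funext => x /=; rewrite qcoordD.
Qed.

Lemma qintegralZ (a : R) f : qintegrable f ->
  qintegral (fun x => a *: f x) = a *: qintegral f.
Proof.
move=> fi; apply: qcoordP => k; rewrite qcoordZ !qcoord_integral.
by under eq_Rintegral do rewrite qcoordZ; rewrite RintegralZl.
Qed.

Lemma qintegralZr (a : R * R -> R) q :
  (leb2 R).-integrable setT (EFin \o a) ->
  qintegral (fun x => a x *: q) = (\int[leb2 R]_x a x) *: q.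
Proof.
move=> ai; apply: qcoordP => k; rewrite qcoordZ !qcoord_integral.
by under eq_Rintegral do rewrite qcoordZ; rewrite RintegralZr.
Qed.

Lemma qintegrableZr (a : R * R -> R) q :
  (leb2 R).-integrable setT (EFin \o a) ->
  qintegrable (fun x => a x *: q).
Proof.
move=> ai k; rewrite (_ : EFin \o _ = fun x => ((a x)%:E * (qcoord k q)%:E)%E).
  by apply: (integrableZr measurableT (qcoord k q)) ai.
by apply/funext => x /=; rewrite qcoordZ EFinM.
Qed.

(** Each coordinate of [p * f x * q] is a fixed real-linear combination of the
    coordinates of [f x], so this is linearity of the real integral. *)
Lemma qintegralM p q f : qintegrable f ->
  qintegral (fun x => p * f x * q) = p * qintegral f * q.
Proof.
move=> fi.
have E (r : quat R) : p * r * q = q0 r *: (p * q) + q1 r *: (p * quat_i R * q) +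
    q2 r *: (p * quat_j R * q) + q3 r *: (p * quat_k R * q).
  by case: p q r => a b c e [a' b' c' e'] [a'' b'' c'' e''];
    congr Quat => /=; ring.
have h k r : qintegrable (fun x => qcoord k (f x) *: r).
  exact: qintegrableZr.
under eq_qintegral do rewrite E.
rewrite [RHS]E !qintegralD; do ?[exact: (h 0%N)|exact: (h 1%N)|exact: (h 2%N)
  |exact: (h 3%N)|apply: qintegrableD].
rewrite (qintegralZr _ (fi 0%N)) (qintegralZr _ (fi 1%N))
  (qintegralZr _ (fi 2%N)) (qintegralZr _ (fi 3%N)).
by [].
Qed.

Lemma qFubini (G : (R * R) * (R * R) -> quat R) (f g : R * R -> R) :
  qmeas G ->
  (leb2 R).-integrable setT (EFin \o f) ->
  (leb2 R).-integrable setT (EFin \o g) ->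
  (forall x y, qabs (G (x, y)) <= f x * g y) ->
  qintegral (fun x => qintegral (fun y => G (x, y))) =
  qintegral (fun y => qintegral (fun x => G (x, y))).
Proof.
move=> mG fi gi Gfg; apply: qcoordP => k; rewrite !qcoord_integral.
under eq_Rintegral do rewrite qcoord_integral.
under [RHS]eq_Rintegral do rewrite qcoord_integral.
apply: (@Fubini_dominated _ _ _ _ _ (@plane_measure R) (@plane_measure R)
  _ f g (mG k) fi gi) => x y.
exact: le_trans (qcoord_le_qabs _ _) (Gfg x y).
Qed.

Lemma qmeas_integral (G : (R * R) * (R * R) -> quat R) :
  qmeas G -> qmeas (fun x => qintegral (fun y => G (x, y))).
Proof.
move=> mG k; under eq_fun do rewrite qcoord_integral.
exact: (measurable_Rintegral_param (@plane_measure R) (mG k)).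
Qed.

Lemma qdominated_convergence (f_ : (R * R -> quat R)^nat) f (F : R * R -> R) k :
  (forall n, qmeas (f_ n)) -> qmeas f ->
  {ae leb2 R, forall x, qcoord k (f_ n x) @[n --> \oo] --> qcoord k (f x)} ->
  (leb2 R).-integrable setT (EFin \o F) ->
  (forall n x, qabs (f_ n x) <= F x) ->
  qcoord k (qintegral (f_ n)) @[n --> \oo] --> qcoord k (qintegral f).
Proof.
move=> mf_ mf f_f Fi fF; rewrite qcoord_integral.
under eq_fun do rewrite qcoord_integral.
apply: (Rdominated_convergence _ _ f_f Fi).
- by move=> n; exact: mf_.
- exact: mf.
- by move=> n x; exact: le_trans (qcoord_le_qabs _ _) (fF n x).
Qed.

Lemma qcoord_integral_le k f (F : R * R -> R) : qmeas f ->
  (leb2 R).-integrable setT (EFin \o F) -> (forall x, qabs (f x) <= F x) ->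
  `|qcoord k (qintegral f)| <= \int[leb2 R]_x F x.
Proof.
move=> mf Fi fF; rewrite qcoord_integral.
have fi := qintegrable_dominated mf Fi fF k.
apply: (le_trans (le_normr_Rintegral measurableT fi)).
apply: le_Rintegral => //; first exact: (integrable_abse fi).
by move=> x _; exact: le_trans (qcoord_le_qabs _ _) (fF x).
Qed.

End QuatIntegral.

(** * The Poisson kernel on the line *)

Section Poisson1.
Variable R : realType.
Local Notation mu := (@lebesgue_measure R).
Implicit Types e a b u y : R.

Lemma is_derive_continuous (F f : R -> R) :
  (forall x : R, is_derive x 1 F (f x)) -> continuous F.
Proof.
move=> dF x; apply: differentiable_continuous; apply/derivable1_diffP.
exact: ex_derive.
Qed.

(** The regularising factor in one frequency variable, whose Fourier transform is
    the Poisson kernel [poisson e]. *)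
Definition damping e u : R := expR (- (e * `|u|)).

(** The kernel normalised to have integral [2 * pi]; its two copies, one for each
    variable, are the origin of the factor [4 * pi ^+ 2]. *)
Definition poisson e x : R := 2 * e / (e ^+ 2 + x ^+ 2).

Lemma damping_ge0 e u : 0 <= damping e u.
Proof. exact: expR_ge0. Qed.

Lemma continuous_damping e : continuous (damping e).
Proof.
move=> u; apply: continuous_comp; last exact: continuous_expR.
by apply: cvgN; apply: cvgM; [exact: cvg_cst|exact: norm_continuous].
Qed.

Lemma measurable_damping e : measurable_fun setT (damping e).
Proof. by apply: continuous_measurable_fun; exact: continuous_damping. Qed.

Lemma continuous_cosM a : continuous (fun u => cos (a * u)).
Proof.
move=> u; apply: continuous_comp; last exact: continuous_cos.
exact: mulrl_continuous.
Qed.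

Lemma continuous_sinM a : continuous (fun u => sin (a * u)).
Proof.
move=> u; apply: continuous_comp; last exact: continuous_sin.
exact: mulrl_continuous.
Qed.

(** The primitive of [expR (- (e * u)) * (1 + cos (a * u))] that vanishes at
    infinity when [e] is positive. Adding 1 to the cosine keeps the integrand nonnegative, so that
    the improper integral is given by the limit of the primitive. *)
Definition damping_primitive e a u : R :=
  expR (- (e * u)) *
  ((a * sin (a * u) - e * cos (a * u)) / (e ^+ 2 + a ^+ 2) - e^-1).

Lemma is_derive_damping_primitive e a (x : R) : 0 < e ->
  is_derive x 1 (damping_primitive e a)
    (expR (- (e * x)) * (1 + cos (a * x))).
Proof.
move=> e0; have d0 : e ^+ 2 + a ^+ 2 != 0.
  by rewrite gt_eqF// ltr_pwDl ?exprn_gt0// sqr_ge0.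
have dM c : is_derive x 1 ( *%R c) c.
  exact: (is_derive_eq (is_deriveZ c (is_derive_id x 1)) (mulr1 c)).
have dcos : is_derive x 1 (fun u => cos (a * u)) (- sin (a * x) * a).
  exact: (@is_derive1_comp _ (@cos R) ( *%R a) x).
have dsin : is_derive x 1 (fun u => sin (a * u)) (cos (a * x) * a).
  exact: (@is_derive1_comp _ (@sin R) ( *%R a) x).
have dexp : is_derive x 1 (fun u => expR (- (e * u))) (expR (- (e * x)) * - e).
  exact: (@is_derive1_comp _ (@expR R) (- ( *%R e)) x).
have dn := is_deriveB (is_deriveZ a dsin) (is_deriveZ e dcos).
have dq := is_deriveB (is_deriveZ (e ^+ 2 + a ^+ 2)^-1 dn) (is_derive_cst e^-1 x 1).
have dF := is_deriveM dexp dq.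
rewrite (_ : damping_primitive e a = (fun u => expR (- (e * u))) *
    ((e ^+ 2 + a ^+ 2)^-1 \*: (a \*: (fun u => sin (a * u)) -
       e \*: (fun u => cos (a * u))) - cst e^-1)); last first.
  apply/funext => u; rewrite /damping_primitive [RHS]/=; congr (_ * (_ - _)).
  exact: mulrC.
apply: (is_derive_eq dF); rewrite /GRing.scale /=.
rewrite (_ : (_ - cst _ : R -> R) x = (e ^+ 2 + a ^+ 2)^-1 *
  (a * sin (a * x) - e * cos (a * x)) - e^-1)//.
by field; rewrite d0 gt_eqF.
Qed.

Lemma cvgy_expRN_M e : 0 < e -> expR (- (e * u)) @[u --> +oo] --> (0 : R).
Proof.
move=> e0; apply: (@cvg_comp _ _ _ ( *%R e) (fun z => expR (- z)) _
  (pinfty_nbhs R)); last exact: cvgr_expR.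
exact: gt0_cvgMry.
Qed.

Lemma cvgy_damping_primitive e a : 0 < e ->
  damping_primitive e a u @[u --> +oo] --> (0 : R).
Proof.
move=> e0; have d0 : 0 < e ^+ 2 + a ^+ 2.
  by rewrite ltr_pwDl ?exprn_gt0// sqr_ge0.
pose C := (`|a| + e) / (e ^+ 2 + a ^+ 2) + e^-1.
have ei : 0 <= e^-1 by rewrite invr_ge0 ltW.
have di : 0 <= (e ^+ 2 + a ^+ 2)^-1 by rewrite invr_ge0 ltW.
have b u : `|damping_primitive e a u| <= C * expR (- (e * u)).
  rewrite /damping_primitive normrM (ger0_norm (expR_ge0 _)) mulrC.
  apply: ler_wpM2r; first exact: expR_ge0.
  apply: (le_trans (ler_normB _ _)).
  rewrite (ger0_norm ei) lerD2r normrM (ger0_norm di); apply: ler_wpM2r => //.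
  apply: (le_trans (ler_normB _ _)).
  have s1 : `|sin (a * u)| <= 1 by rewrite ler_norml sin_geN1 sin_le1.
  have c1 : `|cos (a * u)| <= 1 by rewrite ler_norml cos_geN1 cos_le1.
  rewrite !normrM (gtr0_norm e0); apply: lerD; rewrite -[leRHS]mulr1.
    exact: ler_wpM2l.
  by apply: ler_wpM2l => //; exact: ltW.
have C0 : C * expR (- (e * u)) @[u --> +oo] --> (0 : R).
  by rewrite -(mulr0 C); apply: cvgM; [exact: cvg_cst|exact: cvgy_expRN_M].
apply/cvgr0Pnorm_lt => eps eps0.
have /cvgr0Pnorm_lt /(_ _ eps0) := C0.
apply: filterS => u; apply: le_lt_trans; rewrite (le_trans (b u))//.
exact: ler_norm.
Qed.

Lemma integral_damping1Dcos e a : 0 < e ->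
  (\int[mu]_u (damping e u * (1 + cos (a * u)))%:E =
   (2 * e^-1 + 2 * (e / (e ^+ 2 + a ^+ 2)))%:E)%E.
Proof.
move=> e0.
rewrite ge0_symfun_integralT.
- rewrite -set_itvcy.
  transitivity (2%:E * \int[mu]_(u in `[0%R, +oo[)
      (expR (- (e * u)) * (1 + cos (a * u)))%:E)%E.
    congr (_ * _)%E; apply: eq_integral => u; rewrite inE/= in_itv/= andbT => u0.
    by rewrite /damping ger0_norm.
  rewrite (ge0_continuous_FTC2y (F := damping_primitive e a) (l := 0)).
  + rewrite -EFinB -EFinM; congr EFin; rewrite /damping_primitive.
    rewrite !mulr0 sin0 cos0 oppr0 expR0; ring.
  + move=> u _; apply: mulr_ge0; first exact: expR_ge0.
    by have := cos_geN1 (a * u); rewrite addrC -lerBlDr sub0r.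
  + apply: continuous_subspaceT => u; apply: cvgM.
      apply: continuous_comp; last exact: continuous_expR.
      by apply: cvgN; exact: mulrl_continuous.
    by apply: cvgD; [exact: cvg_cst|exact: continuous_cosM].
  + exact: cvgy_damping_primitive.
  + by move=> x _; have d := is_derive_damping_primitive a x e0; exact: ex_derive.
  + apply: cvg_at_right_filter.
    apply: is_derive_continuous => x; exact: is_derive_damping_primitive.
  + move=> x _; rewrite derive1E.
    by have d := is_derive_damping_primitive a x e0; rewrite derive_val.
- move=> u; apply: mulr_ge0; first exact: damping_ge0.
  by have := cos_geN1 (a * u); rewrite addrC -lerBlDr sub0r.
- move=> u; apply: cvgM; first exact: continuous_damping.
  by apply: cvgD; [exact: cvg_cst|exact: continuous_cosM].
- by move=> u /=; rewrite /damping normrN mulrN cosN.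
Qed.

Lemma integrable_damping1Dcos e a : 0 < e ->
  mu.-integrable setT (EFin \o (fun u => damping e u * (1 + cos (a * u)))).
Proof.
move=> e0.
have ge0 u : 0 <= damping e u * (1 + cos (a * u)).
  apply: mulr_ge0; first exact: damping_ge0.
  by have := cos_geN1 (a * u); rewrite addrC -lerBlDr sub0r.
apply/integrableP; split.
  apply/measurable_EFinP; apply: continuous_measurable_fun => u.
  apply: cvgM; first exact: continuous_damping.
  by apply: cvgD; [exact: cvg_cst|exact: continuous_cosM].
under eq_integral do rewrite /= ger0_norm//.
by rewrite integral_damping1Dcos// ltry.
Qed.

Lemma integrable_damping e : 0 < e -> mu.-integrable setT (EFin \o damping e).
Proof.
move=> e0; apply: integrable_dominated (integrable_damping1Dcos 0 e0) _.
  exact: measurable_damping.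
move=> u; rewrite mul0r cos0 ger0_norm ?damping_ge0//.
by rewrite mulrDr mulr1 lerDl damping_ge0.
Qed.

Lemma integrable_dampingM e (h : R -> R) : 0 < e -> continuous h ->
  (forall u, `|h u| <= 1) ->
  mu.-integrable setT (EFin \o (fun u => damping e u * h u)).
Proof.
move=> e0 ch h1; apply: integrable_dominated (integrable_damping e0) _.
  apply: measurable_funM; first exact: measurable_damping.
  exact: continuous_measurable_fun.
move=> u; rewrite normrM ger0_norm ?damping_ge0//.
by rewrite -[leRHS]mulr1 ler_wpM2l// damping_ge0.
Qed.

Lemma integrable_dampingMcos e a : 0 < e ->
  mu.-integrable setT (EFin \o (fun u => damping e u * cos (a * u))).
Proof.
move=> e0; apply: integrable_dampingM => //; first exact: continuous_cosM.
by move=> u; rewrite ler_norml cos_geN1 cos_le1.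
Qed.

Lemma integrable_dampingMsin e a : 0 < e ->
  mu.-integrable setT (EFin \o (fun u => damping e u * sin (a * u))).
Proof.
move=> e0; apply: integrable_dampingM => //; first exact: continuous_sinM.
by move=> u; rewrite ler_norml sin_geN1 sin_le1.
Qed.

(** The cosine integral for [a = 0], where [1 + cos] is the constant 2. *)
Lemma Rintegral_damping e : 0 < e -> \int[mu]_u damping e u = 2 / e.
Proof.
move=> e0.
have : \int[mu]_u (damping e u * (1 + cos (0 * u))) = 2 * e^-1 + 2 * e^-1.
  rewrite /Rintegral integral_damping1Dcos//= expr0n addr0.
  by field; rewrite gt_eqF.
under eq_Rintegral do rewrite mul0r cos0 mulrDr mulr1.
by rewrite RintegralD//; try exact: integrable_damping; lra.
Qed.

Lemma Rintegral_damping_cos e a : 0 < e ->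
  \int[mu]_u (damping e u * cos (a * u)) = poisson e a.
Proof.
move=> e0.
have : \int[mu]_u (damping e u * (1 + cos (a * u))) =
    2 * e^-1 + poisson e a.
  by rewrite /Rintegral integral_damping1Dcos//= /poisson mulrA.
under eq_Rintegral do rewrite mulrDr mulr1.
rewrite RintegralD//; [|exact: integrable_damping|exact: integrable_dampingMcos].
by rewrite Rintegral_damping// => /addrI.
Qed.

Lemma Rintegral_odd (f : R -> R) : mu.-integrable setT (EFin \o f) ->
  (forall u, f (- u) = - f u) -> \int[mu]_u f u = 0.
Proof.
move=> fi fN.
have mf : measurable_fun setT (EFin \o f) by exact: measurable_int fi.
have mN : measurable_fun setT (-%R : measurableTypeR R -> measurableTypeR R) by [].
have fNi : mu.-integrable ((-%R : measurableTypeR R -> measurableTypeR R) @^-1` setT)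
    ((EFin \o f) \o -%R).
  rewrite preimage_setT (_ : _ \o _ = (fun u => - (EFin \o f) u)%E).
    exact: integrableN.
  by apply/funext => u /=; rewrite fN.
have := integral_pushforward mN mf fNi measurableT.
rewrite preimage_setT => E.
have fE : (\int[mu]_u (f u)%:E = \int[mu]_u (f (- u))%:E)%E.
  rewrite -[RHS]E; apply: eq_measure_integral => A mA _.
  exact/esym/lebesgue_measureN.
have : \int[mu]_u f u = - \int[mu]_u f u.
  rewrite -mulN1r -RintegralZl// {1}/Rintegral fE -/(Rintegral _ _ _).
  by apply: eq_Rintegral => u _; rewrite fN mulN1r.
lra.
Qed.

Lemma Rintegral_damping_sin e a : 0 < e ->
  \int[mu]_u (damping e u * sin (a * u)) = 0.
Proof.
move=> e0; apply: Rintegral_odd; first exact: integrable_dampingMsin.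
by move=> u; rewrite /damping normrN mulrN sinN mulrN.
Qed.

Lemma poisson_bounds e x : 0 < e -> 0 <= poisson e x <= 2 / e.
Proof.
move=> e0; have d0 : 0 < e ^+ 2 + x ^+ 2.
  by rewrite ltr_pwDl ?exprn_gt0// sqr_ge0.
rewrite /poisson; apply/andP; split.
  by apply: divr_ge0; [apply: mulr_ge0|]; apply/ltW.
rewrite ler_pdivrMr// mulrAC ler_pdivlMr// -mulrA ler_wpM2l//.
by rewrite -expr2 lerDl sqr_ge0.
Qed.

Lemma continuous_poisson e y : 0 < e -> continuous (fun x => poisson e (x - y)).
Proof.
move=> e0 x; have d0 : 0 < e ^+ 2 + (x - y) ^+ 2.
  by rewrite ltr_pwDl ?exprn_gt0// sqr_ge0.
apply: cvgM; first exact: cvg_cst.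
apply: cvgV; first by rewrite gt_eqF.
apply: cvgD; first exact: cvg_cst.
rewrite expr2; under eq_fun do rewrite expr2.
by apply: cvgM; apply: cvgB; [exact: cvg_id|exact: cvg_cst|exact: cvg_id|
  exact: cvg_cst].
Qed.

Lemma is_derive_atanM e y (x : R) : 0 < e ->
  is_derive x 1 (fun x : R => 2 * atan ((x - y) / e)) (poisson e (x - y)).
Proof.
move=> e0; have d0 : e ^+ 2 + (x - y) ^+ 2 != 0.
  by rewrite gt_eqF// ltr_pwDl ?exprn_gt0// sqr_ge0.
have dl : is_derive x 1 (fun x : R => (x - y) / e) e^-1.
  rewrite (_ : (fun x : R => (x - y) / e) = e^-1 \*: (id - cst y)).
    apply: (is_derive_eq (is_deriveZ e^-1 (is_deriveB (is_derive_id x 1)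
      (is_derive_cst y x 1)))).
    by rewrite subr0 /GRing.scale /= mulr1.
  by apply/funext => z; rewrite mulrC.
have da := @is_derive1_comp _ (@atan R) _ x _ _ (is_derive1_atan _) dl.
apply: (is_derive_eq (is_deriveZ 2 da)).
rewrite /GRing.scale /= /poisson; field.
by rewrite d0 gt_eqF.
Qed.

(** For [a < b], the convolution of the indicator of ]a, b] with [poisson e]. *)
Definition smoothed_indic e a b y : R :=
  2 * atan ((b - y) / e) - 2 * atan ((a - y) / e).

Lemma Rintegral_poisson e a b y : 0 < e -> a < b ->
  \int[mu]_x (\1_(`]a, b]%classic) x * poisson e (x - y)) =
  smoothed_indic e a b y.
Proof.
move=> e0 ab.
transitivity (\int[mu]_(x in `[a, b]) poisson e (x - y)).
  rewrite -(Rintegral_itv_obnd_cbnd (r := a)); last first.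
    apply: (@integrableS _ _ _ mu `[a, b]%classic) => //.
      exact: subset_itv_oc_cc.
    apply: continuous_compact_integrable; first exact: segment_compact.
    by apply: continuous_subspaceT; exact: continuous_poisson.
  rewrite [RHS]Rintegral_mkcond; apply: eq_Rintegral => x _.
  by rewrite patchE indicE; case: ifP; rewrite ?mul1r ?mul0r.
rewrite /Rintegral (continuous_FTC2 (F := fun x => 2 * atan ((x - y) / e)))//.
- by apply: continuous_subspaceT; exact: continuous_poisson.
- split.
  + by move=> x _; have d := is_derive_atanM y x e0; exact: ex_derive.
  + apply: cvg_at_right_filter.
    exact: (is_derive_continuous (fun x => is_derive_atanM y x e0)).
  + apply: cvg_at_left_filter.
    exact: (is_derive_continuous (fun x => is_derive_atanM y x e0)).
- move=> x _; rewrite derive1E.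
  by have d := is_derive_atanM y x e0; rewrite derive_val.
Qed.

Lemma smoothed_indic_bound e a b y : `|smoothed_indic e a b y| <= 2 * pi.
Proof.
have lo := @atan_gtNpi2 R; have hi := @atan_ltpi2 R.
rewrite /smoothed_indic ler_norml.
have := lo ((b - y) / e); have := lo ((a - y) / e).
have := hi ((b - y) / e); have := hi ((a - y) / e).
lra.
Qed.

Lemma measurable_smoothed_indic e a b : measurable_fun setT (smoothed_indic e a b).
Proof.
have m c : measurable_fun setT (fun y : R => 2 * atan ((c - y) / e)).
  apply: continuous_measurable_fun => y; apply: cvgM; first exact: cvg_cst.
  apply: continuous_comp; last exact: continuous_atan.
  apply: cvgM; last exact: cvg_cst.
  by apply: cvgB; [exact: cvg_cst|exact: cvg_id].
exact: measurable_funB.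
Qed.

Lemma cvg_atan_scaled (c : R) : c != 0 ->
  atan (c / n.+1%:R^-1) @[n --> \oo] --> Num.sg c * (pi / 2).
Proof.
have ny : (n.+1%:R : R) @[n --> \oo] --> +oo.
  by rewrite (cvg_shiftS (fun n : nat => n%:R : R)); exact: cvgr_idn.
have P (d : R) : 0 < d -> atan (d * n.+1%:R) @[n --> \oo] --> (pi / 2 : R).
  move=> d0; apply: (@cvg_comp _ _ _ (fun n : nat => d * n.+1%:R) atan _
    (pinfty_nbhs R)); last exact: cvgy_atan.
  apply: (@cvg_comp _ _ _ (fun n : nat => n.+1%:R : R) ( *%R d) _ _ _ ny).
  by apply: gt0_cvgMry d0 _; exact: cvg_id.
under eq_fun do rewrite invrK.
have [c0|c0|//] := ltrgt0P c => _.
  by rewrite gtr0_sg// mul1r; exact: P.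
rewrite ltr0_sg// mulN1r.
under eq_fun => n do rewrite -[atan _]opprK -atanN -mulNr.
by apply: cvgN; apply: P; rewrite oppr_gt0.
Qed.

(** At the endpoints the limit is half the value of the jump, so they have to be
    excluded. *)
Lemma cvg_smoothed_indic a b y : a < b -> y != a -> y != b ->
  smoothed_indic n.+1%:R^-1 a b y @[n --> \oo] -->
  2 * pi * \1_(`]a, b]%classic) y.
Proof.
move=> ab ya yb; rewrite indicE.
have -> : 2 * pi * (y \in `]a, b]%classic)%:R =
    2 * (Num.sg (b - y) * (pi / 2)) - 2 * (Num.sg (a - y) * (pi / 2)) :> R.
  have -> : (y \in `]a, b]%classic) = (a < y) && (y < b).
    by rewrite mem_setE in_itv/= lt_neqAle [y <= b]le_eqVlt (negbTE yb) eq_sym ya.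
  have [ay|ay] := ltP a y; last first.
    have {}ay : y < a by rewrite lt_neqAle ya.
    rewrite !gtr0_sg ?subr_gt0//; [|exact: lt_trans ab].
    by rewrite subrr mulr0.
  rewrite (ltr0_sg (x := a - y)) ?subr_lt0//.
  have [yb'|yb'] := ltP y b.
    by rewrite gtr0_sg ?subr_gt0//=; field.
  rewrite ltr0_sg ?subr_lt0 ?lt_neqAle 1?eq_sym ?yb//=.
  by rewrite mulr0 subrr.
by apply: cvgB; apply: cvgM; [exact: cvg_cst|apply: cvg_atan_scaled|
  exact: cvg_cst|apply: cvg_atan_scaled]; rewrite subr_eq0 eq_sym.
Qed.

End Poisson1.

(** * Damped inversion on the plane *)

Section PlaneKernel.
Variable R : realType.
Implicit Types (e a b c d : R) (x y w : R * R) (q : quat R).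

Definition damping2 e w : R := damping e w.1 * damping e w.2.

Definition poisson2 e x y : R := poisson e (x.1 - y.1) * poisson e (x.2 - y.2).

Definition box_indic a b c d x : R :=
  \1_(`]a, b]%classic) x.1 * \1_(`]c, d]%classic) x.2.

Definition smoothed_box e a b c d y : R :=
  smoothed_indic e a b y.1 * smoothed_indic e c d y.2.

(** The candidate inverse transform, without its factor [(4 * pi ^+ 2)^-1]. *)
Definition qinverse (F : R * R -> quat R) x : quat R :=
  qintegral (fun w => qexpi (x.1 * w.1) * F w * qexpj (x.2 * w.2)).

Lemma qmeas_inverse_kernel (F : R * R -> quat R) : qmeas F ->
  qmeas (fun z : (R * R) * (R * R) =>
    qexpi (z.1.1 * z.2.1) * F z.2 * qexpj (z.1.2 * z.2.2)).
Proof.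
by move=> mF; apply: qmeas_sandwich; [apply: measurable_funM; exact: measurableT_comp
  |apply: measurable_funM; exact: measurableT_comp|exact: qmeas_comp mF _].
Qed.

Lemma qmeas_inverse_integrand (F : R * R -> quat R) x : qmeas F ->
  qmeas (fun w => qexpi (x.1 * w.1) * F w * qexpj (x.2 * w.2)).
Proof.
by move=> /qmeas_inverse_kernel mE; exact: (qmeas_comp mE (measurable_pair1 x)).
Qed.

Lemma qmeas_inverse (F : R * R -> quat R) : qmeas F -> qmeas (qinverse F).
Proof. by move=> mF; exact: (qmeas_integral (qmeas_inverse_kernel mF)). Qed.

(** The constant 4 comes from bounding the modulus by the sum of the absolute
    values of the four coordinates. *)
Lemma qabs_inverse_le (F : R * R -> quat R) (G : R * R -> R) x : qmeas F ->
  (leb2 R).-integrable setT (EFin \o G) -> (forall w, qabs (F w) <= G w) ->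
  qabs (qinverse F x) <= 4 * \int[leb2 R]_w G w.
Proof.
move=> mF Gi FG; set M := \int[leb2 R]_w G w.
have h k : `|qcoord k (qinverse F x)| <= M.
  apply: qcoord_integral_le Gi _; first exact: qmeas_inverse_integrand.
  by move=> w; rewrite qabs_sandwich.
apply: (le_trans (qabs_le_sum _)).
rewrite (_ : 4 * M = M + M + M + M); last by ring.
exact: (lerD (lerD (lerD (h 0%N) (h 1%N)) (h 2%N)) (h 3%N)).
Qed.

Lemma sandwich_scale (r t u : R) q :
  qexpi t * (r *: q) * qexpj u = r *: (qexpi t * q * qexpj u).
Proof. by rewrite -scalerAr -scalerAl. Qed.

Lemma integrable_damping2 e : 0 < e ->
  (leb2 R).-integrable setT (EFin \o damping2 e).
Proof. by move=> e0; apply: integrable_tensor; exact: integrable_damping. Qed.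

Lemma damping2_ge0 e w : 0 <= damping2 e w.
Proof. by apply: mulr_ge0; exact: damping_ge0. Qed.

Lemma damping2_le1 e w : 0 < e -> damping2 e w <= 1.
Proof.
move=> e0; have h u : damping e u <= 1.
  by rewrite /damping -expR0 ler_expR oppr_le0 mulr_ge0// ltW.
by rewrite /damping2 mulr_ile1// ?damping_ge0.
Qed.

Lemma measurable_damping2 e : measurable_fun setT (damping2 e).
Proof.
by apply: measurable_funM; apply: measurableT_comp => //;
  exact: measurable_damping.
Qed.

(** Of the four terms of the two-sided kernel only the product of cosines
    survives, the damping being even. *)
Lemma qintegral_damping_kernel e a b q : 0 < e ->
  qintegral (fun w => damping2 e w *: (qexpi (a * w.1) * q * qexpj (b * w.2))) =
  (poisson e a * poisson e b) *: q.
Proof.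
move=> e0.
pose C (u : R) := damping e u * cos (a * u).
pose S (u : R) := damping e u * sin (a * u).
pose C' (u : R) := damping e u * cos (b * u).
pose S' (u : R) := damping e u * sin (b * u).
have Ci := integrable_dampingMcos a e0; have Si := integrable_dampingMsin a e0.
have Ci' := integrable_dampingMcos b e0; have Si' := integrable_dampingMsin b e0.
transitivity (qintegral (fun w => (C w.1 * C' w.2) *: q +
    (C w.1 * S' w.2) *: (q * quat_j R) + (S w.1 * C' w.2) *: (quat_i R * q) +
    (S w.1 * S' w.2) *: (quat_i R * q * quat_j R))).
  apply: eq_qintegral => w; rewrite sandwichE !scalerDr !scalerA /C /S /C' /S'.
  by rewrite /damping2; congr (_ *: _ + _ *: _ + _ *: _ + _ *: _); ring.
rewrite !qintegralD; do ?[by apply: qintegrableZr; exact: integrable_tensor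
  |apply: qintegrableD].
rewrite !(qintegralZr _ (integrable_tensor _ _))//.
rewrite !Rintegral_tensor// !Rintegral_damping_cos// !Rintegral_damping_sin//.
by rewrite !(mul0r, mulr0, scale0r, addr0).
Qed.

Variable f : R * R -> quat R.
Hypothesis fi : qintegrable f.

(** Fubini's theorem applies thanks to the domination of the integrand by
    [damping2 e w * qabs (f y)]. *)
Lemma qFourier_damped e x : 0 < e ->
  qinverse (fun w => damping2 e w *: qFourier f w) x =
  qintegral (fun y => poisson2 e x y *: f y).
Proof.
move=> e0; have mf := qintegrable_meas fi.
pose G (z : (R * R) * (R * R)) := damping2 e z.1 *:
  (qexpi ((x.1 - z.2.1) * z.1.1) * f z.2 * qexpj ((x.2 - z.2.2) * z.1.2)).
transitivity (qintegral (fun w => qintegral (fun y => G (w, y)))).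
  apply: eq_qintegral => w; rewrite sandwich_scale -qintegralM; last first.
    apply: qintegrable_dominated (integrable_qabs fi) _.
      by apply: qmeas_sandwich => //; apply: measurableT_comp => //;
        apply: measurable_funM.
    by move=> y; rewrite qabs_sandwich.
  rewrite -qintegralZ; last first.
    apply: qintegrable_dominated (integrable_qabs fi) _.
      apply: qmeasM; last exact: qmeas_cst.
      apply: qmeasM; first exact: qmeas_cst.
      by apply: qmeas_sandwich => //; apply: measurableT_comp => //;
        apply: measurable_funM.
    by move=> y; rewrite !qabs_sandwich.
  apply: eq_qintegral => y; rewrite /G /=; congr (_ *: _).
  rewrite !mulrA -qexpiD -!mulrA -qexpjD.
  by congr (qexpi _ * (_ * qexpj _)); ring.
rewrite (qFubini (f := damping2 e) (g := fun y => qabs (f y))).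
- apply: eq_qintegral => y; rewrite /G /=.
  by rewrite (qintegral_damping_kernel (x.1 - y.1) (x.2 - y.2)).
- apply: qmeasZ.
    by apply: measurableT_comp => //; exact: measurable_damping2.
  apply: qmeas_sandwich; last exact: qmeas_comp mf _.
    apply: measurable_funM; last exact: measurableT_comp.
    by apply: measurable_funB => //; exact: measurableT_comp.
  apply: measurable_funM; last exact: measurableT_comp.
  by apply: measurable_funB => //; exact: measurableT_comp.
- exact: integrable_damping2.
- exact: integrable_qabs.
- move=> w y; rewrite qabsZ qabs_sandwich /= ger0_norm//.
  exact: damping2_ge0.
Qed.

Lemma poisson2_bounds e x y : 0 < e -> 0 <= poisson2 e x y <= (2 / e) ^+ 2.
Proof.
move=> e0; have /andP[l1 u1] := poisson_bounds (x.1 - y.1) e0.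
have /andP[l2 u2] := poisson_bounds (x.2 - y.2) e0.
by rewrite mulr_ge0//= expr2 ler_pM.
Qed.

Lemma measurable_poisson e : 0 < e -> measurable_fun setT (poisson e).
Proof.
move=> e0; rewrite (_ : poisson e = fun u => poisson e (u - 0)); last first.
  by apply/funext => u; rewrite subr0.
by apply: continuous_measurable_fun; exact: continuous_poisson.
Qed.

Lemma measurable_poisson2 e : 0 < e ->
  measurable_fun setT (fun z : (R * R) * (R * R) => poisson2 e z.1 z.2).
Proof.
move=> e0.
have m (u : R * R -> R) : measurable_fun setT u ->
    measurable_fun setT (fun z : (R * R) * (R * R) => poisson e (u z.1 - u z.2)).
  move=> mu; apply: (measurableT_comp (f := poisson e)).
    exact: measurable_poisson.
  by apply: measurable_funB; apply: (measurableT_comp mu).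
by apply: measurable_funM; apply: m.
Qed.

Lemma integrable_box_indic a b c d :
  (leb2 R).-integrable setT (EFin \o box_indic a b c d).
Proof. by apply: integrable_tensor; exact: integrable_indic_itv. Qed.

Lemma measurable_box_indic a b c d : measurable_fun setT (box_indic a b c d).
Proof. by apply: measurable_funM; apply: measurableT_comp. Qed.

Lemma box_indic_bounds a b c d x : 0 <= box_indic a b c d x <= 1.
Proof.
rewrite /box_indic !indicE; do 2 case: (_ \in _);
  by rewrite ?(mulr0, mul0r, mulr1) ?lexx ?ler01.
Qed.

Lemma integrable_indic_poisson e a b (y : R) : 0 < e ->
  (@lebesgue_measure R).-integrable setT
    (EFin \o (fun u => \1_(`]a, b]%classic) u * poisson e (u - y))).
Proof.
move=> e0.
have ii : (@lebesgue_measure R).-integrable setT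
    (EFin \o (fun u => 2 / e * \1_(`]a, b]%classic) u)).
  apply: integrable_scale; exact: integrable_indic_itv.
apply: integrable_dominated ii _.
  apply: measurable_funM => //; apply: continuous_measurable_fun.
  exact: continuous_poisson.
move=> u; have /andP[p0 p1] := poisson_bounds (u - y) e0.
rewrite normrM (ger0_norm p0) ger0_norm// mulrC.
by apply: ler_wpM2r.
Qed.

(** Another application of Fubini's theorem: for fixed [e] the kernel is bounded,
    and the box has finite measure. *)
Lemma qintegral_box_poisson e a b c d : 0 < e -> a < b -> c < d ->
  qintegral (fun x => box_indic a b c d x *:
    qintegral (fun y => poisson2 e x y *: f y)) =
  qintegral (fun y => smoothed_box e a b c d y *: f y).
Proof.
move=> e0 ab cd; have mf := qintegrable_meas fi.
have mp2 : measurable_fun setT (fun z : (R * R) * (R * R) => poisson2 e z.1 z.2).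
  exact: measurable_poisson2.
have gi : (leb2 R).-integrable setT
    (EFin \o (fun y => (2 / e) ^+ 2 * qabs (f y))).
  apply: integrable_scale; exact: integrable_qabs.
pose G (z : (R * R) * (R * R)) :=
  (box_indic a b c d z.1 * poisson2 e z.1 z.2) *: f z.2.
transitivity (qintegral (fun x => qintegral (fun y => G (x, y)))).
  apply: eq_qintegral => x; rewrite -qintegralZ; last first.
    apply: qintegrable_dominated gi _.
      apply: qmeasZ mf.
      exact: (measurableT_comp mp2 (measurable_pair1 x)).
    move=> y; have /andP[p0 p1] := poisson2_bounds x y e0.
    by rewrite qabsZ ger0_norm//; apply: ler_wpM2r => //; exact: qabs_ge0.
  by apply: eq_qintegral => y; rewrite scalerA.
rewrite (qFubini (f := box_indic a b c d)
  (g := fun y => (2 / e) ^+ 2 * qabs (f y))).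
- apply: eq_qintegral => y; rewrite /G /=.
  transitivity (qintegral (fun x =>
    ((\1_(`]a, b]%classic) x.1 * poisson e (x.1 - y.1)) *
     (\1_(`]c, d]%classic) x.2 * poisson e (x.2 - y.2))) *: f y)).
    by apply: eq_qintegral => x; congr (_ *: _);
      rewrite /box_indic /poisson2; ring.
  have i1 := integrable_indic_poisson a b y.1 e0.
  have i2 := integrable_indic_poisson c d y.2 e0.
  rewrite (qintegralZr _ (integrable_tensor i1 i2)) (Rintegral_tensor i1 i2).
  by rewrite !Rintegral_poisson.
- apply: qmeasZ; last exact: qmeas_comp mf _.
  apply: measurable_funM mp2.
  by apply: measurableT_comp => //; exact: measurable_box_indic.
- exact: integrable_box_indic.
- exact: gi.
- move=> x y; rewrite qabsZ /= normrM.
  have /andP[b0 _] := box_indic_bounds a b c d x.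
  have /andP[p0 p1] := poisson2_bounds x y e0.
  rewrite (ger0_norm b0) (ger0_norm p0) -mulrA; apply: ler_wpM2l => //.
  by apply: ler_wpM2r => //; exact: qabs_ge0.
Qed.

(** The boundary of a box lies on four lines, each of measure 0. *)
Lemma ae_off_lines a b c d : {ae leb2 R, forall y,
  [/\ y.1 != a, y.1 != b, y.2 != c & y.2 != d]}.
Proof.
pose N := (([set a] `*` setT) `|` ([set b] `*` setT)) `|`
  ((setT `*` [set c]) `|` (setT `*` [set d])) : set (R * R).
have fst0 (u : R) : leb2 R ([set u] `*` setT) = 0%E.
  have -> : leb2 R ([set u] `*` setT) =
      (@lebesgue_measure R [set u] * @lebesgue_measure R setT)%E.
    by apply: product_measure1E.
  by rewrite lebesgue_measure_set1 mul0e.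
have snd0 (u : R) : leb2 R (setT `*` [set u]) = 0%E.
  have -> : leb2 R (setT `*` [set u]) =
      (@lebesgue_measure R setT * @lebesgue_measure R [set u])%E.
    by apply: product_measure1E.
  by rewrite lebesgue_measure_set1 mule0.
have mfst (u : R) : measurable
    ([set u] `*` setT : set (measurableTypeR R * measurableTypeR R)).
  exact: measurableX.
have msnd (u : R) : measurable
    (setT `*` [set u] : set (measurableTypeR R * measurableTypeR R)).
  exact: measurableX.
exists N; split.
- by apply: measurableU; apply: measurableU; apply: measurableX.
- have U1 := null_set_setU (mfst a) (mfst b) (fst0 a) (fst0 b).
  have U2 := null_set_setU (msnd c) (msnd d) (snd0 c) (snd0 d).
  by apply: null_set_setU U1 U2; exact: measurableU.
- move=> y /= ny; apply: contrapT => yN; apply: ny; split;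
    apply/negP => /eqP ye; apply: yN.
  + by left; left; split.
  + by left; right; split.
  + by right; left; split.
  + by right; right; split.
Qed.

Lemma cvg_damping2 w : damping2 n.+1%:R^-1 w @[n --> \oo] --> (1 : R).
Proof.
have h (u : R) : damping n.+1%:R^-1 u @[n --> \oo] --> (1 : R).
  rewrite -[X in _ --> X]expR0; apply: (@continuous_cvg _ _ _ _ _ _ expR).
    exact: continuous_expR.
  rewrite -[X in _ --> X]oppr0 -(mul0r `|u|); apply: cvgN.
  apply: cvgM; last exact: cvg_cst.
  exact: cvg_harmonic.
by rewrite -[X in _ --> X]mulr1; apply: cvgM.
Qed.

Lemma cvg_qcoordZ k (a_ : nat -> R) (q_ : nat -> quat R) (l : R) q :
  a_ n @[n --> \oo] --> l -> qcoord k (q_ n) @[n --> \oo] --> qcoord k q ->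
  qcoord k (a_ n *: q_ n) @[n --> \oo] --> qcoord k (l *: q).
Proof.
move=> al ql; rewrite qcoordZ.
rewrite (_ : (fun n => _) = fun n => a_ n * qcoord k (q_ n)).
  exact: cvgM.
by apply/funext => n; rewrite qcoordZ.
Qed.

Lemma qabs_damped_le e F w : 0 < e -> qabs (damping2 e w *: F) <= qabs F.
Proof.
move=> e0; rewrite qabsZ ger0_norm ?damping2_ge0//.
by rewrite ler_piMl ?qabs_ge0// damping2_le1.
Qed.

Lemma cvg_qinverse_damped (F : R * R -> quat R) x k : qintegrable F ->
  qcoord k (qinverse (fun w => damping2 n.+1%:R^-1 w *: F w) x) @[n --> \oo] -->
  qcoord k (qinverse F x).
Proof.
move=> Fi; have mF := qintegrable_meas Fi.
have cw w : qcoord k (qexpi (x.1 * w.1) * (damping2 n.+1%:R^-1 w *: F w) *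
      qexpj (x.2 * w.2)) @[n --> \oo] -->
    qcoord k (qexpi (x.1 * w.1) * F w * qexpj (x.2 * w.2)).
  rewrite (_ : (fun n => _) = fun n => qcoord k (damping2 n.+1%:R^-1 w *:
      (qexpi (x.1 * w.1) * F w * qexpj (x.2 * w.2)))); last first.
    by apply/funext => n; rewrite sandwich_scale.
  rewrite -[X in _ --> qcoord k X]scale1r.
  by apply: cvg_qcoordZ; [exact: cvg_damping2|exact: cvg_cst].
apply: qdominated_convergence (integrable_qabs Fi) _.
- move=> n; apply: qmeas_inverse_integrand; apply: qmeasZ => //.
  exact: measurable_damping2.
- exact: qmeas_inverse_integrand.
- exact: aeW.
- by move=> n w; rewrite qabs_sandwich; apply: qabs_damped_le.
Qed.

Hypothesis Ffi : qintegrable (qFourier f).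

(** Both sides are limits, along [e = 1 / (n + 1)], of the two sides of
    [qintegral_box_poisson], rewritten by [qFourier_damped]. *)
Lemma qintegral_box_inversion a b c d : a < b -> c < d ->
  qintegral (fun x => box_indic a b c d x *: qinverse (qFourier f) x) =
  qintegral (fun y => (4 * pi ^+ 2 * box_indic a b c d y) *: f y).
Proof.
move=> ab cd; have mf := qintegrable_meas fi; have mF := qintegrable_meas Ffi.
have Fi := integrable_qabs Ffi; have fi' := integrable_qabs fi.
pose e n : R := n.+1%:R^-1.
have e0 n : 0 < e n by rewrite invr_gt0.
pose F_ n w := damping2 (e n) w *: qFourier f w.
have mF_ n : qmeas (F_ n) by apply: qmeasZ => //; exact: measurable_damping2.
pose M := \int[leb2 R]_w qabs (qFourier f w).
apply: qcoordP => k.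
have L : qcoord k (qintegral (fun x => box_indic a b c d x *: qinverse (F_ n) x))
    @[n --> \oo] -->
    qcoord k (qintegral (fun x => box_indic a b c d x *: qinverse (qFourier f) x)).
  have di : (leb2 R).-integrable setT
      (EFin \o (fun x => 4 * M * box_indic a b c d x)).
    apply: integrable_scale; exact: integrable_box_indic.
  have cx x : qcoord k (box_indic a b c d x *: qinverse (F_ n) x) @[n --> \oo] -->
      qcoord k (box_indic a b c d x *: qinverse (qFourier f) x).
    by apply: cvg_qcoordZ; [exact: cvg_cst|exact: cvg_qinverse_damped].
  apply: qdominated_convergence di _.
  - move=> n; apply: qmeasZ; first exact: measurable_box_indic.
    exact: qmeas_inverse.
  - by apply: qmeasZ; [exact: measurable_box_indic|exact: qmeas_inverse].
  - exact: aeW.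
  - move=> n x; have /andP[b0 _] := box_indic_bounds a b c d x.
    rewrite qabsZ (ger0_norm b0) mulrC; apply: ler_wpM2r => //.
    by apply: qabs_inverse_le => // w; exact: qabs_damped_le.
have D : qcoord k (qintegral (fun y => smoothed_box (e n) a b c d y *: f y))
    @[n --> \oo] -->
    qcoord k (qintegral (fun y => (4 * pi ^+ 2 * box_indic a b c d y) *: f y)).
  have di : (leb2 R).-integrable setT
      (EFin \o (fun x => (2 * pi) * (2 * pi) * qabs (f x))).
    exact: integrable_scale.
  have cy y : [/\ y.1 != a, y.1 != b, y.2 != c & y.2 != d] ->
      qcoord k (smoothed_box (e n) a b c d y *: f y) @[n --> \oo] -->
      qcoord k ((4 * pi ^+ 2 * box_indic a b c d y) *: f y).
    move=> [ya yb yc yd]; apply: cvg_qcoordZ; last exact: cvg_cst.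
    rewrite (_ : _ * _ = (2 * pi * \1_(`]a, b]%classic) y.1) *
      (2 * pi * \1_(`]c, d]%classic) y.2)); last by rewrite /box_indic; ring.
    by apply: cvgM; exact: cvg_smoothed_indic.
  apply: qdominated_convergence di _.
  - move=> n; apply: qmeasZ => //; apply: measurable_funM;
      apply: measurableT_comp => //; exact: measurable_smoothed_indic.
  - apply: qmeasZ => //; apply: measurable_funM => //.
    exact: measurable_box_indic.
  - exact: (ae_leb2S cy (ae_off_lines a b c d)).
  - move=> n y; rewrite qabsZ; apply: ler_wpM2r; first exact: qabs_ge0.
    by rewrite normrM; apply: ler_pM => //; exact: smoothed_indic_bound.
have En n : qintegral (fun x => box_indic a b c d x *: qinverse (F_ n) x) =
    qintegral (fun y => smoothed_box (e n) a b c d y *: f y).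
  rewrite -(qintegral_box_poisson (e0 n) ab cd); apply: eq_qintegral => x.
  by rewrite (qFourier_damped x (e0 n)).
have E : (fun n => qcoord k (qintegral
      (fun x => box_indic a b c d x *: qinverse (F_ n) x))) =
    (fun n => qcoord k (qintegral
      (fun y => smoothed_box (e n) a b c d y *: f y))).
  by apply/funext => n; rewrite En.
by rewrite E in L; exact: cvg_unique L D.
Qed.

End PlaneKernel.

(** * Functions with zero integral over every box *)

Section BoxUniqueness.
Variable R : realType.
Local Notation plane := (measurableTypeR R * measurableTypeR R)%type.

(** Products of half-open intervals, empty ones included, so that they are closed
    under intersection. *)
Definition boxes : set (set plane) :=
  [set A `*` B | A in @ocitv R & B in @ocitv R].

Lemma boxes_setI_closed : setI_closed boxes.
Proof.
move=> _ _ [A oA [B oB <-]] [C oC [D oD <-]]; rewrite -setXI.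
by exists (A `&` C); [exact: ocitvI|exists (B `&` D) => //; exact: ocitvI].
Qed.

Lemma measurable_boxes : boxes `<=` @measurable _ plane.
Proof.
by move=> _ [A oA [B oB <-]]; apply: measurableX; exact: sub_sigma_algebra.
Qed.

Definition centered_box (n : nat) : set plane :=
  `](- n%:R), n%:R]%classic `*` `](- n%:R), n%:R]%classic.

Lemma centered_box_boxes n : boxes (centered_box n).
Proof.
exists `](- n%:R), n%:R]%classic; first exact: is_ocitv.
by exists `](- n%:R), n%:R]%classic => //; exact: is_ocitv.
Qed.

(** A product set is an intersection of two strips, and a strip over a half-open
    interval is a countable union of boxes. *)
Lemma measurable_plane_boxes : @measurable _ plane = <<s boxes >>.
Proof.
apply/seteqP; split; last first.
  apply: smallest_sub; first exact: sigma_algebra_measurable.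
  exact: measurable_boxes.
have strip_fst A : ocitv A -> <<s boxes >> (A `*` setT).
  move=> oA; rewrite -(bigcup_itvT false false) setX_bigcupr.
  apply: sigma_algebra_bigcup => n; apply: sub_sigma_algebra.
  exists A => //; exists `](- n%:R), n%:R]%classic => //; exact: is_ocitv.
have strip_snd B : ocitv B -> <<s boxes >> (setT `*` B).
  move=> oB; rewrite -(bigcup_itvT false false) setX_bigcupl.
  apply: sigma_algebra_bigcup => n; apply: sub_sigma_algebra.
  by exists `](- n%:R), n%:R]%classic; [exact: is_ocitv|exists B].
apply: smallest_sub; first exact: smallest_sigma_algebra.
rewrite subUset; split.
- rewrite [X in X `<=` _](_ : _ = <<s preimage_set_system setT fst (@ocitv R) >>).
    apply: smallest_sub; first exact: smallest_sigma_algebra.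
    move=> _ [A oA <-]; rewrite setTI (_ : _ @^-1` _ = A `*` setT).
      exact: strip_fst.
    by apply/seteqP; split => [x|x []].
  by rewrite g_sigma_preimageE.
- rewrite [X in X `<=` _](_ : _ = <<s preimage_set_system setT snd (@ocitv R) >>).
    apply: smallest_sub; first exact: smallest_sigma_algebra.
    move=> _ [B oB <-]; rewrite setTI (_ : _ @^-1` _ = setT `*` B).
      exact: strip_snd.
    by apply/seteqP; split => [x|x []].
  by rewrite g_sigma_preimageE.
Qed.

(** Inside a large box [h] is integrable, and the sets over which its integral is
    0 are closed under complement and disjoint countable union: by Dynkin's
    theorem they include all the Borel sets. *)
Lemma ae_eq0_boxes (h : R * R -> R) :
  (forall D, boxes D -> (leb2 R).-integrable D (EFin \o h)) ->
  (forall D, boxes D -> (\int[leb2 R]_(x in D) (h x)%:E = 0)%E) ->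
  {ae leb2 R, forall x, h x = 0}.
Proof.
move=> hi h0.
have local n : ae_eq (leb2 R) (centered_box n) (EFin \o h) (cst 0%E).
  have oI := centered_box_boxes n.
  have mI := measurable_boxes oI.
  have int0 S : @measurable _ plane S ->
      (\int[leb2 R]_(x in S `&` centered_box n) (h x)%:E = 0)%E.
    rewrite measurable_plane_boxes; move: S.
    apply: (@dynkin_induction _ plane boxes (fun S =>
      (\int[leb2 R]_(x in S `&` centered_box n) (h x)%:E = 0)%E)).
    - exact: measurable_plane_boxes.
    - exact: boxes_setI_closed.
    - by rewrite setTI; exact: h0.
    - move=> D oD; apply: h0; exact: (boxes_setI_closed oD oI).
    - move=> A mA A0.
      have := h0 _ oI; rewrite -{1}(setTI (centered_box n)) -(setUv A) setIUl.
      rewrite integral_setU//=.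
      + by rewrite A0 add0e.
      + exact: measurableI.
      + by apply: measurableI => //; exact: measurableC.
      + rewrite -setIUl setUv setTI.
        exact: (measurable_int _ (hi _ oI)).
      + apply/disj_set2P; rewrite setIACA setIid setICr set0I//.
    - move=> F mF tF F0; rewrite setI_bigcupl integral_bigcup.
      + by apply: eseries0 => k _ _; exact: F0.
      + exact: trivIset_setIr.
      + by move=> k; exact: measurableI.
      + apply: integrableS (hi _ oI) => //; last first.
          by move=> x [k _ []].
        by apply: bigcupT_measurable => k; exact: measurableI.
  apply: integral_ae_eq => //; first exact: hi.
  move=> E EI mE; rewrite integral0.
  by rewrite -[RHS](int0 _ mE) (setIidl EI).
apply: negligibleS (negligible_bigcup local) => x /= hx.
(* The centered boxes exhaust the plane. *)
pose n := Num.bound (`|x.1| + `|x.2|).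
have xn : `|x.1| + `|x.2| < n%:R by apply: archi_boundP; exact: addr_ge0.
exists n => //= /(_ _) xI; apply: hx; apply: EFin_inj; apply: xI.
have := ler_norm x.1; have := ler_norm (- x.1); have := normr_ge0 x.1.
have := ler_norm x.2; have := ler_norm (- x.2); have := normr_ge0 x.2.
rewrite !normrN => *.
by split; rewrite /= in_itv /=; apply/andP; split; lra.
Qed.

End BoxUniqueness.

(** * The inversion theorem *)

Section Inversion.
Variable R : realType.
Implicit Types (f g : R * R -> quat R) (a b c d : R).

Lemma box_indicE a b c d x :
  box_indic a b c d x = \1_(`]a, b]%classic `*` `]c, d]%classic) x :> R.
Proof.
by rewrite /box_indic !indicE in_setX; case: (_ \in _);
  rewrite ?mul1r ?mul0r.
Qed.

Lemma qintegrable_qabs f : qmeas f ->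
  (\int[leb2 R]_x (qabs (f x))%:E < +oo)%E -> qintegrable f.
Proof.
move=> mf fy; apply: (qintegrable_dominated (F := fun x => qabs (f x))) => //.
apply/integrableP; split.
  by apply/measurable_EFinP; exact: measurable_qabs.
by under eq_integral do rewrite /= ger0_norm ?qabs_ge0//.
Qed.

(** The transform only depends on the class of [f] modulo null sets, so a Borel
    representative suffices. *)
Lemma qL1_borel f : qL1 f ->
  exists2 g, qintegrable g & {ae leb2 R, forall x, f x = g x}.
Proof.
move=> [[g mg fg] fy]; exists g => //.
apply: qintegrable_qabs; first exact/qmeasP.
have fgk : {ae leb2 R, forall x, (qabs (g x))%:E = (qabs (f x))%:E}.
  by apply: (ae_leb2S _ fg) => x ->.
by rewrite (nonmeasurable_ae_eq_integral fgk).
Qed.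

Lemma qmeas_Fourier f : qmeas f -> qmeas (qFourier f).
Proof.
move=> mf; apply: (@qmeas_integral _ (fun z : (R * R) * (R * R) =>
  qexpi (- (z.1.1 * z.2.1)) * f z.2 * qexpj (- (z.1.2 * z.2.2)))).
by apply: qmeas_sandwich; [|
  |exact: qmeas_comp mf _]; apply: measurableT_comp => //;
  apply: measurable_funM; exact: measurableT_comp.
Qed.

(** The difference between the inverse transform and [4 * pi ^+ 2] times [f] has
    integral 0 over every box, coordinate by coordinate. *)
Lemma qFourier_inversion_ae f : qintegrable f -> qintegrable (qFourier f) ->
  {ae leb2 R, forall x : R * R,
    f x = (4 * pi ^+ 2)^-1 *:
      qintegral (fun w => qexpi (x.1 * w.1) * qFourier f w
                          * qexpj (x.2 * w.2))}.
Proof.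
move=> fi Fi; have mf := qintegrable_meas fi; have mF := qintegrable_meas Fi.
set C := 4 * pi ^+ 2.
have C0 : C != 0 :> R by rewrite mulf_neq0// expf_neq0// gt_eqF// pi_gt0.
pose h k (x : R * R) := qcoord k (qinverse (qFourier f) x - C *: f x).
have hbox a b c d k : a < b -> c < d ->
  (leb2 R).-integrable setT (EFin \o (fun x => box_indic a b c d x * h k x)) /\
  (\int[leb2 R]_x (box_indic a b c d x * h k x) = 0).
  move=> ab cd.
  have bi := integrable_box_indic a b c d.
  have gi : qintegrable (fun x => box_indic a b c d x *: qinverse (qFourier f) x).
    apply: (@qintegrable_dominated _ _ (fun x =>
      (4 * \int[leb2 R]_w qabs (qFourier f w)) * box_indic a b c d x)).
    - by apply: qmeasZ; [exact: measurable_box_indic|exact: qmeas_inverse].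
    - exact: integrable_scale.
    - move=> x; have /andP[b0 _] := box_indic_bounds a b c d x.
      rewrite qabsZ (ger0_norm b0) mulrC; apply: ler_wpM2r => //.
      by apply: qabs_inverse_le => //; exact: integrable_qabs.
  have fbi : qintegrable (fun x => (C * box_indic a b c d x) *: f x).
    apply: (@qintegrable_dominated _ _ (fun x => C * qabs (f x))).
    - apply: qmeasZ => //; apply: measurable_funM => //.
      exact: measurable_box_indic.
    - by apply: integrable_scale; exact: integrable_qabs.
    - move=> x; have /andP[b0 b1] := box_indic_bounds a b c d x.
      have Cp : 0 <= C by rewrite mulr_ge0// sqr_ge0.
      rewrite qabsZ (ger0_norm (mulr_ge0 Cp b0)) -mulrA; apply: ler_wpM2l => //.
      by rewrite ler_piMl// qabs_ge0.
  have hE x : box_indic a b c d x * h k x =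
      qcoord k (box_indic a b c d x *: qinverse (qFourier f) x) -
      qcoord k ((C * box_indic a b c d x) *: f x).
    by rewrite /h -qcoordZ scalerBr scalerA -qcoordB mulrC.
  split.
    rewrite (_ : EFin \o _ = fun x => ((EFin \o (fun x =>
      qcoord k (box_indic a b c d x *: qinverse (qFourier f) x))) x -
      (EFin \o (fun x => qcoord k ((C * box_indic a b c d x) *: f x))) x)%E).
      exact: (integrableB measurableT (gi k) (fbi k)).
    by apply/funext => x /=; rewrite hE EFinB.
  under eq_Rintegral do rewrite hE.
  rewrite (RintegralB measurableT (gi k) (fbi k)) -!qcoord_integral.
  by rewrite (qintegral_box_inversion fi Fi ab cd) subrr.
have h0 k : {ae leb2 R, forall x, h k x = 0}.
  have E a b c d : (fun x => box_indic a b c d x * h k x) =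
      (h k \_ (`]a, b]%classic `*` `]c, d]%classic)).
    apply/funext => x; rewrite box_indicE patchE indicE.
    by case: ifP; rewrite ?mul1r ?mul0r.
  have mbox a b c d : measurable (`]a, b]%classic `*` `]c, d]%classic :
      set (measurableTypeR R * measurableTypeR R)).
    by apply: measurableX; exact: measurable_itv.
  apply: ae_eq0_boxes => D [A /ocitvP[->|[[a b] /= ab ->]]
    [B /ocitvP[->|[[c d] /= cd ->]] <-]]; rewrite ?set0X ?setX0;
    try exact: integrable_set0; try exact: integral_set0.
  - apply/(integrable_mkcond _ (mbox _ _ _ _)); rewrite restrict_EFin -E.
    exact: (hbox a b c d k ab cd).1.
  - rewrite integral_mkcond restrict_EFin -E.
    have [hi hz] := hbox a b c d k ab cd.
    by rewrite -(fineK (integrable_fin_num measurableT hi)); congr EFin.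
have hall : {ae leb2 R, forall x k, h k x = 0}.
  exact: ae_foralln.
apply: (ae_leb2S _ hall) => x hx.
have : qinverse (qFourier f) x - C *: f x = 0.
  by apply: qcoordP => k; rewrite [LHS]hx; case: k => [|[|[|k]]].
by move/subr0_eq; rewrite -/(qinverse _ _) => ->; rewrite scalerA mulVf// scale1r.
Qed.

End Inversion.

Theorem theorem3p5 (R : realType) (f : R * R -> quat R)
  (f_L1 : qL1 f) (Ff_L1 : qL1 (qFourier f)) :
  {ae leb2 R, forall x : R * R,
    f x = (4 * pi ^+ 2)^-1 *:
      qintegral (fun w => qexpi (x.1 * w.1) * qFourier f w
                          * qexpj (x.2 * w.2))}.
Proof.
have [g gi fg] := qL1_borel f_L1.
have FfE : qFourier f = qFourier g.
  apply/funext => w; apply: qintegral_ae_eq.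
  by apply: (ae_leb2S _ fg) => x ->.
have Fgi : qintegrable (qFourier g).
  apply: qintegrable_qabs; first by apply: qmeas_Fourier; exact: qintegrable_meas.
  by rewrite -FfE; exact: Ff_L1.2.
rewrite FfE.
have both := ae_leb2I fg (qFourier_inversion_ae gi Fgi).
by apply: (ae_leb2S _ both) => x [-> ].
Qed.
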